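(* Fix $\tau>0$, $h>0$ and $\{\rho_i^n\in P_{h,\delta}\}_{i=1}^s$ for some $\delta>0$. Then the function $\mathcal F_h(\rho,m,\phi)$ admits a unique minimizer in $V^n_{h,\delta}\subset\mathbb{R}^{s(2N-1)+N+2}$, where $P_{h,\delta}$, $\mathcal F_h$ and $V^n_{h,\delta}$ are defined in the context.
   Context: Grid: $[a,b]$ is divided into $N$ cells $[x_{j-1/2},x_{j+1/2}]$ of size $h=(b-a)/N$ with $x_{1/2}=a$, $x_{N+1/2}=b$ and centers $x_j=x_{j-1/2}+h/2$, $j=1,\dots,N$. Data: number of species $s\ge1$; $z_i\in\mathbb{R}$; positive functions $D_i$ and $\epsilon$ on $[a,b]$; a function $f$; constants $\beta_a,\beta_b>0$ (Robin conditions at both ends); boundary values $\phi^b(a),\phi^b(b)\in\mathbb{R}$. Write $\epsilon_j=\epsilon(x_j)$, $\epsilon_{j+1/2}=\epsilon(x_{j+1/2})$, $f_j=f(x_j)$, $D_{i,j}=D_i(x_j)$. Unknowns: $u=(\rho,m,\phi)$ with $\rho=(\rho_{i,j})_{1\le i\le s,1\le j\le N}$, $m=(m_{i,j+1/2})_{1\le i\le s,1\le j\le N-1}$ extended by $m_{i,1/2}=m_{i,N+1/2}=0$, and $\phi=(\phi_0,\dots,\phi_{N+1})$. Operators: $(D_hv)_{j+1/2}=(v_{j+1}-v_j)/h$, $(d_hv)_j=(v_{j+1/2}-v_{j-1/2})/h$, $\hat v_j=(v_{j+1/2}+v_{j-1/2})/2$; $\hat m_{i,j}$ denotes the average of $m_i$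 at $j$. Discrete Poisson constraint $L_h(\phi,\rho)=0$ is the system $$(h+2\beta_a\epsilon(a))\phi_0+(h-2\beta_a\epsilon(a))\phi_1-2h\phi^b(a)=0,$$ $$-d_h(\epsilon D_h\phi)_j-f_j-\sum_{i=1}^sz_i\rho_{i,j}=0,\quad j=1,\dots,N,$$ $$(h-2\beta_b\epsilon(b))\phi_N+(h+2\beta_b\epsilon(b))\phi_{N+1}-2h\phi^b(b)=0,$$ where $(\epsilon D_h\phi)_{j+1/2}=\epsilon_{j+1/2}(D_h\phi)_{j+1/2}$. Sets: $P_{h,\delta}=\{(\rho_1,\dots,\rho_N):\rho_j\ge\delta,\ h\sum_{j=1}^N\rho_j=1\}$, and $$V^n_{h,\delta}=\{(\rho,m,\phi):\ \rho_{i,j}-\rho^n_{i,j}+d_h(m_i)_j=0\ \ (1\le i\le s,\ 1\le j\le N),\ \rho\in[P_{h,\delta}]^s,\ L_h(\phi,\rho)=0\},$$ with $m_{i,1/2}=m_{i,N+1/2}=0$. Objective: $$\mathcal F_h(\rho,m,\phi)=\frac h{2\tau}\sum_{j=1}^N\sum_{i=1}^s\frac{\hat m_{i,j}^2}{\rho_{i,j}}D_{i,j}^{-1}+h\sum_{j=1}^N\Big(\sum_{i=1}^s\rho_{i,j}\log\rho_{i,j}+\frac{\epsilon_j}{8h^2}(\phi_{j+1}-\phi_{j-1})^2\Big)+\frac{(\phi_0+\phi_1)^2}{8\beta_a}+\frac{(\phi_N+\phi_{N+1})^2}{8\beta_b}.$$ *)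

(* Defs.v *)
From mathcomp Require Import all_boot all_order all_algebra.
From mathcomp Require Import classical_sets reals exp.

Set Implicit Arguments.
Unset Strict Implicit.
Unset Printing Implicit Defensive.

Import Order.TTheory GRing.Theory Num.Theory.
Local Open Scope classical_set_scope.
Local Open Scope ring_scope.

(* [N] cells and [s] species.  Functions on the interval [pa, pb] are given as
   functions on [R]; only their values on [pa, pb] are ever used. *)
Record pnp_data (R : realType) (s N : nat) := PnpData {
  pa : R;
  pb : R;
  valence : 'I_s -> R;
  diffusion : 'I_s -> R -> R;
  eps : R -> R;
  fixed_charge : R -> R;
  beta_a : R;
  beta_b : R;
  phib_a : R;
  phib_b : R
}.

(* A cell index [j : nat] stands for j (the point x_j); a face index [k : nat]
   stands for k + 1/2 (the point x_{k+1/2}), so that cell j >= 1 has faces j.-1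
   and j.  An ordinal [j : 'I_N] stands for the interior cell j.+1. *)
Section Scheme.
Context {R : realType} {s N : nat} (d : pnp_data R s N).

Definition mesh : R := (pb d - pa d) / N%:R.
Definition face (k : nat) : R := pa d + k%:R * mesh.
Definition center (j : nat) : R := face j.-1 + mesh / 2.

Definition diff_c2f (v : nat -> R) (k : nat) : R := (v k.+1 - v k) / mesh.
Definition diff_f2c (w : nat -> R) (j : nat) : R := (w j - w j.-1) / mesh.
Definition avg_f2c (w : nat -> R) (j : nat) : R := (w j + w j.-1) / 2.

(* Column [l] of [m] holds the flux at the interior face l.+1; the fluxes at
   the faces 0 and N (and, irrelevantly, beyond) are zero. *)
Definition flux (m : 'M[R]_(s, N.-1)) (i : 'I_s) (k : nat) : R :=
  if k is l.+1 then oapp (m i) 0 (insub l) else 0.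

Definition potential (phi : 'rV[R]_N.+2) (j : nat) : R := phi 0 (inord j).

Definition poisson_constraint (phi : 'rV[R]_N.+2) (rho : 'M[R]_(s, N)) : Prop :=
  let p := potential phi in
  let h := mesh in
  [/\ (h + 2 * beta_a d * eps d (pa d)) * p 0%N
        + (h - 2 * beta_a d * eps d (pa d)) * p 1%N - 2 * h * phib_a d = 0,
      forall j : 'I_N,
        - diff_f2c (fun k => eps d (face k) * diff_c2f p k) j.+1
          - fixed_charge d (center j.+1)
          - \sum_(i < s) valence d i * rho i j = 0
    & (h - 2 * beta_b d * eps d (pb d)) * p N
        + (h + 2 * beta_b d * eps d (pb d)) * p N.+1 - 2 * h * phib_b d = 0].

Definition density_set (delta : R) : set 'rV[R]_N :=
  [set r | (forall j, delta <= r 0 j) /\ mesh * \sum_(j < N) r 0 j = 1].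

Definition unknowns : Type :=
  ('M[R]_(s, N) * 'M[R]_(s, N.-1) * 'rV[R]_N.+2)%type.

Definition admissible (delta : R) (rhon : 'M[R]_(s, N)) : set unknowns :=
  fun u => let: (rho, m, phi) := u in
    [/\ forall i j, rho i j - rhon i j + diff_f2c (flux m i) j.+1 = 0,
        forall i, density_set delta (row i rho)
      & poisson_constraint phi rho].

Definition objective (tau : R) (u : unknowns) : R :=
  let: (rho, m, phi) := u in
  let p := potential phi in
  let h := mesh in
  h / (2 * tau) * (\sum_(j < N) \sum_(i < s)
      avg_f2c (flux m i) j.+1 ^+ 2 / rho i j * (diffusion d i (center j.+1))^-1)
  + h * (\sum_(j < N) ((\sum_(i < s) rho i j * ln (rho i j))
      + eps d (center j.+1) / (8 * h ^+ 2) * (p j.+2 - p j) ^+ 2))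
  + (p 0%N + p 1%N) ^+ 2 / (8 * beta_a d)
  + (p N + p N.+1) ^+ 2 / (8 * beta_b d).

End Scheme.

Definition is_minimizer (R : realType) (T : Type) (F : T -> R) (V : set T)
    (u : T) : Prop :=
  V u /\ forall v, V v -> F u <= F v.

(* Main.v *)
From HB Require Import structures.
From mathcomp Require Import all_boot all_order all_algebra.
From mathcomp Require Import ring lra.
From mathcomp Require Import all_classical all_reals all_analysis.
Require Import Defs.

Set Implicit Arguments.
Unset Strict Implicit.
Unset Printing Implicit Defensive.

Import Order.TTheory GRing.Theory Num.Theory.
Import numFieldNormedType.Exports.
Local Open Scope classical_set_scope.
Local Open Scope ring_scope.

(** The density alone carries the problem.  Given an admissible density [rho],
    the continuity equation reads
    m_{j+1/2} = m_{j-1/2} + h (rho^n_j - rho_j), so it determines the flux by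
    summation from the left boundary, where the flux vanishes; equality of the
    masses of [rho] and [rho^n] is what makes the flux vanish at the right
    boundary as well ([continuity_flux_of], [continuity_eq_inj]).  The discrete
    Poisson system is a square linear system in the potential with trivial
    kernel ([poisson_op_eq0]), so it determines the potential
    ([poisson_potential_of]).  Hence the admissible states are exactly the
    states [state_of rho] with [rho] in the density polytope
    ([admissibleP]), and flux and potential depend affinely on [rho].

    Existence: the density polytope is nonempty, since it contains [rho^n], and
    compact: it is closed, and an entry bounded below by [delta] in a row of
    mass 1 is at most 1/h.  The objective composed with [state_of] is
    continuous there because densities stay away from 0, so it attains its
    minimum ([exists_minimizer]).

    Uniqueness: the admissible set is convex, and so is the objective: the
    kinetic term is a sum of perspective functions a^2/x, and the electric
    terms are squares of linear forms.  The entropy x ln x is strictly convex.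
    Comparing two minimizers with their midpoint forces their densities to
    coincide ([objective_midpoint_lt]), hence also their fluxes and
    potentials ([minimizer_unique]).

    Only midpoint convexity is used, always in the form [f + f <= g + k] or
    [f + f < g + k], where [f] is the value at the midpoint and [g], [k] are
    the values at the ends. *)

(** * Midpoint convexity *)

Section MidpointConvexity.
Context {R : realType}.
Implicit Types a b c x y : R.

(** Joint convexity of (a, x) |-> a^2 / x for positive x: the defect is the
    square (a y - b x)^2 over the positive number x y (x + y). *)
Lemma perspective_midpoint_le a b x y : 0 < x -> 0 < y ->
  ((a + b) / 2) ^+ 2 / ((x + y) / 2) + ((a + b) / 2) ^+ 2 / ((x + y) / 2)
  <= a ^+ 2 / x + b ^+ 2 / y.
Proof.
move=> x0 y0; have xy0 : 0 < x + y by exact: addr_gt0.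
have xn : x != 0 by rewrite gt_eqF.
have yn : y != 0 by rewrite gt_eqF.
have xyn : x + y != 0 by rewrite gt_eqF.
rewrite -subr_ge0.
have -> : a ^+ 2 / x + b ^+ 2 / y - (((a + b) / 2) ^+ 2 / ((x + y) / 2)
    + ((a + b) / 2) ^+ 2 / ((x + y) / 2))
    = (a * y - b * x) ^+ 2 / (x * y * (x + y)).
  by field; rewrite xn yn xyn.
by rewrite divr_ge0 ?sqr_ge0 // !mulr_ge0 // ltW.
Qed.

Lemma sqr_midpoint_le a b :
  ((a + b) / 2) ^+ 2 + ((a + b) / 2) ^+ 2 <= a ^+ 2 + b ^+ 2.
Proof.
rewrite -subr_ge0.
have -> : a ^+ 2 + b ^+ 2 - (((a + b) / 2) ^+ 2 + ((a + b) / 2) ^+ 2)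
  = (a - b) ^+ 2 / 2 by field.
by rewrite divr_ge0 ?sqr_ge0.
Qed.

Lemma ln_lt_subr1 x : 0 < x -> x != 1 -> ln x < x - 1.
Proof.
move=> x0 x1; have : ln x != 0 by rewrite ln_eq0.
by move/expR_gt1Dx; rewrite lnK ?posrE// => ?; lra.
Qed.

(** The graph of t |-> t ln t lies strictly above its tangent at [z]; this is
    [ln_lt_subr1] at z / x, multiplied by x. *)
Lemma xlnx_tangent_lt x z : 0 < x -> 0 < z -> x != z ->
  x * ln z + (x - z) < x * ln x.
Proof.
move=> x0 z0 xz.
have /ln_lt_subr1 : 0 < z / x by rewrite divr_gt0.
have -> : z / x != 1.
  apply: contra xz => /eqP e; apply/eqP.
  have xn : x != 0 by rewrite gt_eqF.
  by rewrite -(divfK xn z) e mul1r.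
move=> /(_ isT); rewrite ln_div ?posrE// -(ltr_pM2l x0) !mulrBr mulr1.
rewrite [x * (z / x)]mulrC divfK ?gt_eqF// => ?; lra.
Qed.

(** Sum of the tangent inequalities at the midpoint for the two ends: their
    first-order terms cancel. *)
Lemma xlnx_midpoint_lt x y : 0 < x -> 0 < y -> x != y ->
  (x + y) / 2 * ln ((x + y) / 2) + (x + y) / 2 * ln ((x + y) / 2)
  < x * ln x + y * ln y.
Proof.
move=> x0 y0 xy; set z := (x + y) / 2.
have z0 : 0 < z by rewrite divr_gt0// addr_gt0.
have xz : x != z.
  by apply: contra xy => /eqP e; apply/eqP; move: e; rewrite /z; lra.
have yz : y != z.
  by apply: contra xy => /eqP e; apply/eqP; move: e; rewrite /z; lra.
have := xlnx_tangent_lt x0 z0 xz; have := xlnx_tangent_lt y0 z0 yz.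
have : z * ln z + z * ln z = x * ln z + y * ln z by rewrite /z; field.
have : z + z = x + y by rewrite /z; field.
lra.
Qed.

Lemma xlnx_midpoint_le x y : 0 < x -> 0 < y ->
  (x + y) / 2 * ln ((x + y) / 2) + (x + y) / 2 * ln ((x + y) / 2)
  <= x * ln x + y * ln y.
Proof.
move=> x0 y0; have [->|xy] := eqVneq x y; last exact/ltW/xlnx_midpoint_lt.
by have -> : (y + y) / 2 = y by field.
Qed.

Lemma scale_midpoint_le c (f g k : R) :
  0 <= c -> f + f <= g + k -> c * f + c * f <= c * g + c * k.
Proof. by move=> c0 ?; rewrite -!mulrDr ler_wpM2l. Qed.

Lemma scale_midpoint_lt c (f g k : R) :
  0 < c -> f + f < g + k -> c * f + c * f < c * g + c * k.
Proof. by move=> c0 ?; rewrite -!mulrDr ltr_pM2l. Qed.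

Lemma add_midpoint_le (f g k f' g' k' : R) : f + f <= g + k ->
  f' + f' <= g' + k' -> (f + f') + (f + f') <= (g + g') + (k + k').
Proof. by move=> ? ?; rewrite addrACA [leRHS]addrACA lerD. Qed.

Lemma add_midpoint_ltl (f g k f' g' k' : R) : f + f < g + k ->
  f' + f' <= g' + k' -> (f + f') + (f + f') < (g + g') + (k + k').
Proof. by move=> ? ?; rewrite addrACA [ltRHS]addrACA ltr_leD. Qed.

Lemma add_midpoint_ltr (f g k f' g' k' : R) : f + f <= g + k ->
  f' + f' < g' + k' -> (f + f') + (f + f') < (g + g') + (k + k').
Proof. by move=> ? ?; rewrite addrACA [ltRHS]addrACA ler_ltD. Qed.

Lemma sum_midpoint_le (I : finType) (f g k : I -> R) :
  (forall i, f i + f i <= g i + k i) ->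
  \sum_i f i + \sum_i f i <= \sum_i g i + \sum_i k i.
Proof. by move=> fgk; rewrite -!big_split /= ler_sum. Qed.

Lemma sum_midpoint_lt (I : finType) (f g k : I -> R) (i0 : I) :
  (forall i, f i + f i <= g i + k i) -> f i0 + f i0 < g i0 + k i0 ->
  \sum_i f i + \sum_i f i < \sum_i g i + \sum_i k i.
Proof.
move=> fgk fgk0; rewrite -!big_split /= (bigD1 i0) //= [ltRHS](bigD1 i0) //=.
by rewrite ltr_leD// ler_sum.
Qed.

End MidpointConvexity.

(** * Grid points *)

Section Mesh.
Context {R : realType} {s N : nat} (d : pnp_data R s N).
Hypotheses (N_gt0 : (0 < N)%N) (ltab : pa d < pb d).

Lemma mesh_gt0 : 0 < mesh d.
Proof. by rewrite divr_gt0 ?subr_gt0// ltr0n. Qed.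

Lemma face0 : face d 0 = pa d.
Proof. by rewrite /face mul0r addr0. Qed.

Lemma faceN : face d N = pb d.
Proof.
rewrite /face /mesh mulrC divfK; first by rewrite addrC subrK.
by rewrite pnatr_eq0 -lt0n.
Qed.

Lemma face_itv k : (k <= N)%N -> pa d <= face d k <= pb d.
Proof.
move=> kN; rewrite -faceN /face lerDl lerD2l mulr_ge0 ?ler0n ?(ltW mesh_gt0)//=.
by rewrite ler_wpM2r ?ler_nat// (ltW mesh_gt0).
Qed.

Lemma center_itv j : (j < N)%N -> pa d <= center d j.+1 <= pb d.
Proof.
move=> jN; have /andP[h1 _] := face_itv (ltnW jN); have /andP[_ h2] := face_itv jN.
have h0 := mesh_gt0.
have E : face d j.+1 = face d j + mesh d by rewrite /face -natr1; ring.
rewrite /center /=; move: h1 h2; rewrite E; lra.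
Qed.
End Mesh.

(** * Unique solvability of the discrete Poisson system *)

Section Poisson.
Context {R : realType} {s N : nat} (d : pnp_data R s N).
Implicit Types (phi : 'rV[R]_N.+2) (rho : 'M[R]_(s, N)).

Lemma potentialE phi (k : 'I_N.+2) : potential phi k = phi 0 k.
Proof. by rewrite /potential inord_val. Qed.

(** The rows of the Poisson system, split into a linear part [poisson_op] in
    the potential and a part [poisson_rhs] affine in the density: row 0 is the
    left Robin condition, row [N.+1] the right one, and row k, for
    1 <= k <= N, the equation in cell k. *)
Definition poisson_op phi : 'rV[R]_N.+2 :=
  let p := potential phi in
  let h := mesh d in
  \row_k (if k == 0%N :> nat then
    (h + 2 * beta_a d * eps d (pa d)) * p 0%N
      + (h - 2 * beta_a d * eps d (pa d)) * p 1%N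
  else if k == N.+1 :> nat then
    (h - 2 * beta_b d * eps d (pb d)) * p N
      + (h + 2 * beta_b d * eps d (pb d)) * p N.+1
  else - diff_f2c d (fun k => eps d (face d k) * diff_c2f d p k) k).

(** The density of cell k is stored in column [k.-1]; the default 0 is never
    reached, the boundary rows being handled by the first two branches. *)
Definition poisson_rhs rho : 'rV[R]_N.+2 :=
  \row_k (if k == 0%N :> nat then 2 * mesh d * phib_a d
  else if k == N.+1 :> nat then 2 * mesh d * phib_b d
  else fixed_charge d (center d k)
    + \sum_(i < s) valence d i * oapp (rho i) 0 (insub k.-1)).

Lemma poisson_constraintP phi rho :
  poisson_constraint d phi rho <-> poisson_op phi = poisson_rhs rho.
Proof.
split=> [[pl pj pr]|/rowP pE].
  apply/rowP => k; rewrite !mxE.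
  case: ifPn => [_|k0]; first by apply/eqP; rewrite -subr_eq0 pl.
  case: ifPn => [_|kN]; first by apply/eqP; rewrite -subr_eq0 pr.
  have kN' : (k.-1 < N)%N
    by case: k k0 kN => -[//|k] /= kl _; rewrite eqSS ltn_neqAle => ->.
  rewrite (insubT (fun n => n < N)%N kN') /=.
  have := pj (Ordinal kN'); rewrite /= prednK ?lt0n// => /eqP.
  by rewrite subr_eq0 subr_eq addrC => /eqP.
split.
- by have := pE ord0; rewrite !mxE /= => ->; rewrite subrr.
- move=> j; have jN : (j.+1 < N.+2)%N by rewrite ltnS ltnW// ltnS.
  have := pE (Ordinal jN); rewrite !mxE /= eqSS ltn_eqF// => ->.
  by rewrite valK /= addrAC addrK subrr.
- by have := pE ord_max; rewrite !mxE /= eqxx => ->; rewrite subrr.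
Qed.

Lemma poisson_op_is_linear : linear poisson_op.
Proof.
move=> a x y; apply/rowP => k; rewrite !mxE /diff_f2c /diff_c2f /potential !mxE.
by case: ifP => _; [|case: ifP => _]; ring.
Qed.

HB.instance Definition _ :=
  GRing.isLinear.Build R 'rV[R]_N.+2 'rV[R]_N.+2 *:%R poisson_op
    poisson_op_is_linear.

Hypotheses (N_gt0 : (0 < N)%N) (ltab : pa d < pb d).
Hypothesis (eps_gt0 : forall x, pa d <= x <= pb d -> 0 < eps d x).
Hypotheses (beta_a_gt0 : 0 < beta_a d) (beta_b_gt0 : 0 < beta_b d).

(** In the kernel, the discrete displacement [w] is constant, say c, by the
    interior rows.  So p is increasing if c > 0 and decreasing if c < 0, while
    the Robin rows give p_0 + p_1 = 2 beta_a c and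
    p_N + p_{N+1} = - 2 beta_b c, a change in the opposite direction.
    Quantitatively, let A be the sum of h / eps over the faces 0, ..., N-1 and
    B the sum over the faces 1, ..., N: then
    (A + B + 2 beta_a + 2 beta_b) c = 0, so c = 0, p is constant, and
    p_0 + p_1 = 0 makes it zero. *)
Lemma poisson_op_eq0 phi : poisson_op phi = 0 -> phi = 0.
Proof.
move=> /rowP pE; set p := potential phi; set h := mesh d.
have h0 : 0 < h by exact: mesh_gt0.
have hn : h != 0 by rewrite gt_eqF.
pose w k := eps d (face d k) * diff_c2f d p k.
have wS k : (k < N)%N -> w k.+1 = w k.
  move=> kN; have kN' : (k.+1 < N.+2)%N by rewrite ltnS ltnW.
  have := pE (Ordinal kN'); rewrite !mxE /= eqSS ltn_eqF// => /eqP.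
  rewrite oppr_eq0 mulf_eq0 invr_eq0 (negPf hn) orbF subr_eq0 => /eqP; exact.
have wE k : (k <= N)%N -> w k = w 0%N.
  by elim: k => // k IH kN; rewrite wS// IH// ltnW.
set c := w 0%N in wE.
pose g k := h / eps d (face d k).
have g0 k : (k <= N)%N -> 0 < g k.
  by move=> kN; rewrite divr_gt0// eps_gt0// face_itv.
have pS k : (k <= N)%N -> p k.+1 - p k = c * g k.
  move=> kN; have en : eps d (face d k) != 0 by rewrite gt_eqF// eps_gt0// face_itv.
  by rewrite -(wE k kN) /w /diff_c2f /g -/h; field; rewrite en hn.
have pD j k : (j <= k)%N -> (k <= N.+1)%N ->
    p k - p j = c * \sum_(j <= l < k) g l.
  move=> jk kN; rewrite -(telescope_sumr p jk) mulr_sumr !big_nat.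
  by apply: eq_bigr => l /andP[_ lk]; rewrite pS// -ltnS (leq_trans lk).
have gS_ge0 j k : (k <= N.+1)%N -> 0 <= \sum_(j <= l < k) g l.
  move=> kN; rewrite big_nat sumr_ge0// => l /andP[_ lk].
  by rewrite ltW// g0// -ltnS (leq_trans lk).
have ea : eps d (pa d) * (p 1%N - p 0%N) = h * c.
  by rewrite /c /w face0 /diff_c2f -/h; field.
have eb : eps d (pb d) * (p N.+1 - p N) = h * c.
  by rewrite -(wE N)// /w faceN// /diff_c2f -/h; field.
have pl : p 0%N + p 1%N = 2 * beta_a d * c.
  apply: (mulfI hn); have := pE ord0; rewrite !mxE /= -/p -/h => /eqP.
  rewrite -subr_eq0 => /eqP E; apply/eqP; rewrite -subr_eq0; apply/eqP.
  rewrite -[RHS]E.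
  have -> : h * (2 * beta_a d * c) = 2 * beta_a d * (h * c) by ring.
  by rewrite -ea; ring.
have pr : p N + p N.+1 = - (2 * beta_b d * c).
  apply: (mulfI hn); have := pE ord_max; rewrite !mxE /= eqxx -/p -/h => /eqP.
  rewrite -subr_eq0 => /eqP E; apply/eqP; rewrite -subr_eq0; apply/eqP.
  rewrite -[RHS]E.
  have -> : h * - (2 * beta_b d * c) = - (2 * beta_b d * (h * c)) by ring.
  by rewrite -eb; ring.
have c0 : c = 0.
  (* The increments p_N - p_0 = c A and p_{N+1} - p_1 = c B add up to the
     difference of the two boundary sums. *)
  have E1 := pD 0%N N (leq0n _) (leqnSn _).
  have E2 := pD 1%N N.+1 isT (leqnn _).
  have A0 := gS_ge0 0%N N (leqnSn _); have B0 := gS_ge0 1%N N.+1 (leqnn _).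
  set A := (X in 0 <= X) in A0; set B := (X in 0 <= X) in B0.
  have S0 : A + B + 2 * beta_a d + 2 * beta_b d != 0.
    by rewrite gt_eqF// ltr_wpDl ?mulr_gt0// !addr_ge0 ?mulr_ge0// ltW.
  apply: (mulIf S0); rewrite mul0r !mulrDr -E1 -E2; lra.
apply/rowP => k; rewrite mxE -potentialE -/p.
have := pD 0%N k (leq0n _) (ltn_ord k : k <= N.+1)%N.
have := pD 0%N 1%N isT isT.
by rewrite c0 !mul0r; move: pl; rewrite c0 mulr0; lra.
Qed.

Definition poisson_mx : 'M[R]_N.+2 := lin1_mx poisson_op.

Lemma poisson_mx_unit : poisson_mx \in unitmx.
Proof.
rewrite -row_free_unit; apply: inj_row_free => v.
by rewrite mul_rV_lin1; exact: poisson_op_eq0.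
Qed.

Definition potential_of rho : 'rV[R]_N.+2 := poisson_rhs rho *m invmx poisson_mx.

Lemma poisson_potential_of phi rho :
  poisson_constraint d phi rho <-> phi = potential_of rho.
Proof.
rewrite poisson_constraintP -[poisson_op phi](mul_rV_lin1 poisson_op) /potential_of.
by split=> [<-|->]; rewrite ?mulmxK ?mulmxKV ?poisson_mx_unit.
Qed.
End Poisson.

(** * Fluxes determined by the continuity equation *)

Section Flux.
Context {R : realType} {s N : nat} (d : pnp_data R s N).
Implicit Types (m : 'M[R]_(s, N.-1)) (rhon rho : 'M[R]_(s, N)).

Lemma flux_ord m i (l : 'I_N.-1) : flux m i l.+1 = m i l.
Proof. by rewrite /flux valK. Qed.

Lemma flux_midpoint m1 m2 i k :
  flux (2^-1 *: (m1 + m2)) i k = (flux m1 i k + flux m2 i k) / 2.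
Proof.
case: k => [|l] /=; first by rewrite addr0 mul0r.
by case: insub => [j|] /=; rewrite ?mxE ?addr0 ?mul0r// mulrC.
Qed.

Definition continuity_eq rhon rho m : Prop :=
  forall i j, rho i j - rhon i j + diff_f2c d (flux m i) j.+1 = 0.

(** The sum of the continuity equations over the cells to the left of the
    face. *)
Definition flux_of rhon rho : 'M[R]_(s, N.-1) :=
  \matrix_(i, l) (mesh d * \sum_(j < N | (j <= l)%N) (rhon i j - rho i j)).

Hypotheses (N_gt0 : (0 < N)%N) (ltab : pa d < pb d).

(** Away from the last face this is the definition.  At face [N] the flux is 0
    by convention, and the sum over all cells vanishes because the two masses
    agree. *)
Lemma flux_flux_of rhon rho i k : (k <= N)%N ->
  mesh d * \sum_j rhon i j = mesh d * \sum_j rho i j ->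
  flux (flux_of rhon rho) i k =
    mesh d * \sum_(j < N | (j < k)%N) (rhon i j - rho i j).
Proof.
case: k => [|l] lN massE /=; first by rewrite big_pred0 ?mulr0.
case: insubP => [j _ <-|/= lN'] /=; first by rewrite mxE.
have -> : l = N.-1.
  by apply/eqP; rewrite eqn_leq -ltnS prednK// lN leqNgt lN'.
rewrite (eq_bigl xpredT) => [|j]; last by rewrite prednK// ltn_ord.
by rewrite big_split /= sumrN mulrDr mulrN massE subrr.
Qed.

Lemma continuity_flux_of rhon rho :
  (forall i, mesh d * \sum_j rhon i j = mesh d * \sum_j rho i j) ->
  continuity_eq rhon rho (flux_of rhon rho).
Proof.
move=> massE i j; rewrite /diff_f2c /= -/(flux _ i j.+1).
rewrite !flux_flux_of// ?(ltnW (ltn_ord j))//.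
rewrite (bigD1 j) //= (eq_bigl (fun l : 'I_N => (l < j)%N)) => [|l]; last first.
  by rewrite ltnS andbC -ltn_neqAle.
by field; rewrite gt_eqF// mesh_gt0.
Qed.

(** Both fluxes start from 0 at the left boundary and have the same
    increments. *)
Lemma continuity_eq_inj rhon rho m1 m2 :
  continuity_eq rhon rho m1 -> continuity_eq rhon rho m2 -> m1 = m2.
Proof.
move=> c1 c2; apply/matrixP => i l; rewrite -!flux_ord.
have hn : mesh d != 0 by rewrite gt_eqF// mesh_gt0.
have step m : continuity_eq rhon rho m -> forall j : 'I_N,
    flux m i j.+1 = flux m i j + mesh d * (rhon i j - rho i j).
  move=> /(_ i) + j => /(_ j); rewrite /diff_f2c /= -/(flux _ i j.+1).
  move=> /(congr1 ( *%R (mesh d))); rewrite mulr0.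
  have -> : forall a b c e : R,
      mesh d * (a - b + (c - e) / mesh d) = c - e - mesh d * (b - a).
    by move=> *; field.
  by move/eqP; rewrite subr_eq0 subr_eq addrC => /eqP.
have : (l.+1 <= N)%N by rewrite ltnW// -ltn_predRL ltn_ord.
elim: l.+1 => // k IH kN.
by rewrite (step m1 c1 (Ordinal kN)) (step m2 c2 (Ordinal kN)) /= IH// ltnW.
Qed.
End Flux.

(** * Pointwise continuity of real-valued functions *)

Section PointwiseContinuity.
Context {R : realType}.

Lemma eq_continuous_at (T U : topologicalType) (f g : T -> U) (x : T) :
  g =1 f -> continuous_at x f -> continuous_at x g.
Proof. by move=> /funext->. Qed.

(** This and the next two lemmas restate continuity of the ring operations with
    applied functions, the form in which the summands of the objective unify. *)
Lemma continuous_at_add (T : topologicalType) (f g : T -> R) (x : T) :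
  continuous_at x f -> continuous_at x g -> continuous_at x (fun t => f t + g t).
Proof. exact: continuousD. Qed.

Lemma continuous_at_sub (T : topologicalType) (f g : T -> R) (x : T) :
  continuous_at x f -> continuous_at x g -> continuous_at x (fun t => f t - g t).
Proof. exact: continuousB. Qed.

Lemma continuous_at_mul (T : topologicalType) (f g : T -> R) (x : T) :
  continuous_at x f -> continuous_at x g -> continuous_at x (fun t => f t * g t).
Proof. exact: continuousM. Qed.

Lemma continuous_sum_at (T : topologicalType) (x : T) (I : Type) (r : seq I)
    (P : pred I) (F : I -> T -> R) :
  (forall i, continuous_at x (F i)) ->
  continuous_at x (fun t => \sum_(i <- r | P i) F i t).
Proof.
by move=> cF; apply: cvg_big => [|i _]; [exact: add_continuous|exact: cF].
Qed.

End PointwiseContinuity.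

(** * The problem reduced to the densities *)

Section ReducedProblem.
Context {R : realType} {s N : nat} (d : pnp_data R s N).
Context (tau delta : R) (rhon : 'M[R]_(s, N)).
Hypotheses (N_gt0 : (0 < N)%N) (ltab : pa d < pb d).
Hypothesis (diffusion_gt0 :
  forall i x, pa d <= x <= pb d -> 0 < diffusion d i x).
Hypothesis (eps_gt0 : forall x, pa d <= x <= pb d -> 0 < eps d x).
Hypotheses (beta_a_gt0 : 0 < beta_a d) (beta_b_gt0 : 0 < beta_b d).
Hypotheses (tau_gt0 : 0 < tau) (delta_gt0 : 0 < delta).
Hypothesis (rhonP : forall i, density_set d delta (row i rhon)).

Implicit Types (rho : 'M[R]_(s, N)) (u v : @unknowns R s N).

Definition densities : set 'M[R]_(s, N) :=
  [set rho | forall i, density_set d delta (row i rho)].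

Definition state_of rho : @unknowns R s N :=
  (rho, flux_of d rhon rho, potential_of d rho).

Lemma densities_mass rho i : densities rho -> mesh d * \sum_j rho i j = 1.
Proof. by case/(_ i) => _; under eq_bigr do rewrite mxE. Qed.

Lemma densities_ge rho i j : densities rho -> delta <= rho i j.
Proof. by case/(_ i) => /(_ j); rewrite mxE. Qed.

Lemma densities_gt0 rho i j : densities rho -> 0 < rho i j.
Proof. by move=> D; exact: lt_le_trans delta_gt0 (densities_ge i j D). Qed.

(** The reduction to densities: flux and potential are functions of the
    density. *)
Lemma admissibleP u :
  admissible d delta rhon u <-> densities u.1.1 /\ u = state_of u.1.1.
Proof.
have admE rho : densities rho -> continuity_eq d rhon rho (flux_of d rhon rho).
  move=> Drho; apply: continuity_flux_of => // i.
  by rewrite !densities_mass.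
case: u => [[rho m] phi] /=; split=> [[cm Drho Pphi]|[Drho [-> ->]]].
  split=> //; congr (_, _, _); last exact/poisson_potential_of.
  exact: continuity_eq_inj cm (admE _ Drho).
by split=> //; [exact: admE|exact/poisson_potential_of].
Qed.

(** * Strict convexity *)

Definition midpoint u v : @unknowns R s N :=
  (2^-1 *: (u.1.1 + v.1.1), 2^-1 *: (u.1.2 + v.1.2), 2^-1 *: (u.2 + v.2)).

Lemma admissible_midpoint u v :
  admissible d delta rhon u -> admissible d delta rhon v ->
  admissible d delta rhon (midpoint u v).
Proof.
case: u v => [[r1 m1] p1] [[r2 m2] p2] [c1 D1 P1] [c2 D2 P2]; split=> /=.
- move=> i j; have := c1 i j; have := c2 i j.
  rewrite /diff_f2c !flux_midpoint !mxE => e1 e2.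
  apply: (@mulfI _ 2) => //; rewrite mulr0 -[RHS]addr0 -{1}e1 -{1}e2.
  by field; rewrite gt_eqF// mesh_gt0.
- move=> i; split=> [j|]; rewrite ?mxE.
    by have := densities_ge i j D1; have := densities_ge i j D2; lra.
  under eq_bigr do rewrite !mxE.
  rewrite -mulr_sumr big_split /= mulrCA mulrDr.
  by rewrite (densities_mass i D1) (densities_mass i D2); field.
- move: P1 P2; rewrite !poisson_constraintP => P1 P2.
  rewrite linearZ linearD /= P1 P2; apply/rowP => k; rewrite !mxE.
  case: ifP => _; first by field.
  case: ifP => _; first by field.
  rewrite addrACA -big_split mulrDr mulr_sumr /=; congr (_ + _); first by field.
  apply: eq_bigr => i _; case: insub => [j|] /=; rewrite ?mxE; by field.
Qed.

(** Every summand is midpoint convex, and the entropy summand of a cell and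
    species where the densities differ is strictly so. *)
Lemma objective_midpoint_lt u v :
  admissible d delta rhon u -> admissible d delta rhon v -> u.1.1 != v.1.1 ->
  objective d tau (midpoint u v) + objective d tau (midpoint u v)
  < objective d tau u + objective d tau v.
Proof.
case: u v => [[r1 m1] p1] [[r2 m2] p2] [_ D1 _] [_ D2 _] /= r12.
have h0 := mesh_gt0 N_gt0 ltab.
have [i0 [j0 r12n]] : exists i j, r1 i j != r2 i j.
  apply: contrapT => r12E; move/eqP: r12; apply; apply/matrixP => i j.
  by apply: contrapT => /eqP ?; apply: r12E; exists i, j.
have pot k : potential (2^-1 *: (p1 + p2)) k = (potential p1 k + potential p2 k) / 2.
  by rewrite /potential !mxE mulrC.
have potS (a b c e : R) : (a + b) / 2 + (c + e) / 2 = (a + c + (b + e)) / 2 by field.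
have avg i j : avg_f2c (flux (2^-1 *: (m1 + m2)) i) j
    = (avg_f2c (flux m1 i) j + avg_f2c (flux m2 i) j) / 2.
  by rewrite /avg_f2c !flux_midpoint; field.
have rmid i j : (2^-1 *: (r1 + r2)) i j = (r1 i j + r2 i j) / 2.
  by rewrite !mxE mulrC.
have sq2 (c a b : R) : 0 < c ->
    ((a + b) / 2) ^+ 2 / c + ((a + b) / 2) ^+ 2 / c <= a ^+ 2 / c + b ^+ 2 / c.
  move=> c0; rewrite ![_ / c]mulrC; apply: scale_midpoint_le.
    by rewrite invr_ge0 ltW.
  exact: sqr_midpoint_le.
have pos8 (b : R) : 0 < b -> 0 < 8 * b by move=> b0; rewrite mulr_gt0.
apply: add_midpoint_ltl; last by rewrite !pot potS; exact/sq2/pos8.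
apply: add_midpoint_ltl; last by rewrite !pot potS; exact/sq2/pos8.
apply: add_midpoint_ltr.
  apply: scale_midpoint_le.
    exact: divr_ge0 (ltW h0) (mulr_ge0 (ler0n _ 2) (ltW tau_gt0)).
  apply: sum_midpoint_le => j; apply: sum_midpoint_le => i.
  rewrite avg rmid ![_ * (diffusion _ _ _)^-1]mulrC.
  apply: scale_midpoint_le.
    by rewrite invr_ge0 ltW// diffusion_gt0// center_itv.
  by apply: perspective_midpoint_le; exact: densities_gt0.
apply: scale_midpoint_lt => //.
have fieldE (j : 'I_N) :
    potential (2^-1 *: (p1 + p2)) j.+2 - potential (2^-1 *: (p1 + p2)) j
    = ((potential p1 j.+2 - potential p1 j)
       + (potential p2 j.+2 - potential p2 j)) / 2.
  by rewrite !pot; field.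
have field_le (j : 'I_N) := sqr_midpoint_le (potential p1 j.+2 - potential p1 j)
  (potential p2 j.+2 - potential p2 j).
have fieldc_ge0 (j : 'I_N) : 0 <= eps d (center d j.+1) / (8 * mesh d ^+ 2).
  apply: divr_ge0; first by rewrite ltW// eps_gt0// center_itv.
  by rewrite mulr_ge0// sqr_ge0.
apply: (@sum_midpoint_lt _ _ _ _ _ j0) => [j|].
  apply: add_midpoint_le.
    apply: sum_midpoint_le => i; rewrite rmid.
    by apply: xlnx_midpoint_le; exact: densities_gt0.
  by rewrite fieldE; exact: scale_midpoint_le.
apply: add_midpoint_ltl; last by rewrite fieldE; exact: scale_midpoint_le.
apply: (@sum_midpoint_lt _ _ _ _ _ i0) => [i|]; rewrite rmid.
  by apply: xlnx_midpoint_le; exact: densities_gt0.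
by apply: xlnx_midpoint_lt => //; exact: densities_gt0.
Qed.

(** * Existence and uniqueness *)

(** Densities are flattened into row vectors, so that the compactness of a
    product of segments applies to them. *)
Definition reduced (w : 'rV[R]_(s * N)) : R :=
  objective d tau (state_of (vec_mx w)).

Lemma continuous_entry i j :
  continuous (fun w : 'rV[R]_(s * N) => (vec_mx w : 'M[R]_(s, N)) i j).
Proof.
move=> w; apply: eq_continuous_at => [v|]; first by rewrite mxE.
exact: coord_continuous.
Qed.

Lemma continuous_flux_of i k :
  continuous (fun w : 'rV[R]_(s * N) => flux (flux_of d rhon (vec_mx w)) i k).
Proof.
move=> w; case: k => [|l] /=.
  exact: cst_continuous.
case: insub => [j|] /=; last exact: cst_continuous.
apply: eq_continuous_at => [v|]; first by rewrite mxE.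
apply: continuous_at_mul; first exact: cst_continuous.
apply: continuous_sum_at => n; apply: continuous_at_sub; first exact: cst_continuous.
exact: continuous_entry.
Qed.

Lemma continuous_potential_of k :
  continuous (fun w : 'rV[R]_(s * N) => potential (potential_of d (vec_mx w)) k).
Proof.
move=> w; rewrite /potential; apply: eq_continuous_at => [v|]; first by rewrite mxE.
apply: continuous_sum_at => l; apply: continuous_at_mul; last exact: cst_continuous.
apply: eq_continuous_at => [v|]; first by rewrite mxE.
case: (nat_of_ord l == 0)%N; first exact: cst_continuous.
case: (nat_of_ord l == N.+1); first exact: cst_continuous.
apply: continuous_at_add; first exact: cst_continuous.
apply: continuous_sum_at => i; apply: continuous_at_mul; first exact: cst_continuous.
by case: insub => [j|] /=; [exact: continuous_entry|exact: cst_continuous].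
Qed.

Lemma continuous_reduced w : densities (vec_mx w) -> continuous_at w reduced.
Proof.
move=> Dw.
have sqr_at (f : 'rV[R]_(s * N) -> R) : continuous_at w f ->
    continuous_at w (fun t => f t ^+ 2).
  by move=> cf; exact: (continuous_at_mul cf cf).
have scale_at (f : 'rV[R]_(s * N) -> R) c : continuous_at w f ->
    continuous_at w (fun t => c * f t).
  by move=> cf; apply: continuous_at_mul => //; exact: cst_continuous.
have pot k := @continuous_potential_of k w.
rewrite /reduced /objective /=.
apply: continuous_at_add; last first.
  apply: continuous_at_mul; last exact: cst_continuous.
  by apply: (sqr_at _); apply: continuous_at_add; exact: pot.
apply: continuous_at_add; last first.
  apply: continuous_at_mul; last exact: cst_continuous.
  by apply: (sqr_at _); apply: continuous_at_add; exact: pot.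
apply: continuous_at_add; apply: (scale_at _); apply: continuous_sum_at => j.
  apply: continuous_sum_at => i; apply: continuous_at_mul; last exact: cst_continuous.
  apply: continuous_at_mul.
    apply: (sqr_at _); apply: continuous_at_mul; last exact: cst_continuous.
    by apply: continuous_at_add; exact: continuous_flux_of.
  apply: continuousV; last exact: continuous_entry.
  by rewrite gt_eqF// densities_gt0.
apply: continuous_at_add; last first.
  by apply: (scale_at _); apply: (sqr_at _); apply: continuous_at_sub; exact: pot.
apply: continuous_sum_at => i; apply: continuous_at_mul; first exact: continuous_entry.
apply: (@continuous_comp _ _ _
  (fun v : 'rV[R]_(s * N) => (vec_mx v : 'M[R]_(s, N)) i j) (@ln R)).
  exact: continuous_entry.
by apply: continuous_ln; exact: densities_gt0.
Qed.

(** A closed subset of the box [delta, 1/h]^(s N): in a row of mass 1 with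
    nonnegative entries, no entry exceeds 1/h. *)
Lemma compact_densities :
  compact [set w : 'rV[R]_(s * N) | densities (vec_mx w)].
Proof.
have h0 := mesh_gt0 N_gt0 ltab.
pose box := [set w : 'rV[R]_(s * N) |
  forall k, `[delta, (mesh d)^-1]%classic (w ord0 k)].
have box_compact : compact box.
  by apply: (rV_compact (A := fun=> _)) => k; exact: segment_compact.
apply: (subclosed_compact _ box_compact) => [|w Dw k]; last first.
  case/mxvec_indexP: k => i j.
  have -> : w ord0 (mxvec_index i j) = (vec_mx w : 'M[R]_(s, N)) i j.
    by rewrite mxE.
  rewrite /= in_itv /= densities_ge//= -[(mesh d)^-1]mulr1 -(densities_mass i Dw).
  rewrite mulKf ?gt_eqF// (bigD1 j)//= lerDl sumr_ge0// => l _.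
  exact/ltW/densities_gt0.
pose entry i j := fun w : 'rV[R]_(s * N) => (vec_mx w : 'M[R]_(s, N)) i j.
pose mass i := fun w : 'rV[R]_(s * N) => mesh d * \sum_j entry i j w.
rewrite (_ : [set w | _] = \bigcap_(i in setT)
    (\bigcap_(j in setT) (entry i j @^-1` [set x | delta <= x])
     `&` mass i @^-1` [set x | x = 1])); last first.
  apply/seteqP; split=> w Dw.
    by move=> i _; split=> [j _|]; [exact: densities_ge|exact: densities_mass].
  move=> i; have [/(_ _ I) Dge Dmass] := Dw i I; split=> [j|].
    by rewrite mxE; exact: Dge.
  by rewrite -[RHS]Dmass; congr (_ * _); apply: eq_bigr => j _; rewrite mxE.
apply: closed_bigI => i _; apply: closedI.
  apply: closed_bigI => j _; apply: preimage_closed; last exact: closed_ge.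
  by move=> w _; exact: continuous_entry.
apply: preimage_closed; last exact: closed_eq.
move=> w _; apply: continuous_at_mul; first exact: cst_continuous.
by apply: continuous_sum_at => j; exact: continuous_entry.
Qed.

Lemma exists_minimizer :
  exists u, is_minimizer (objective d tau) (admissible d delta rhon) u.
Proof.
have ne : [set w : 'rV[R]_(s * N) | densities (vec_mx w)] !=set0.
  by exists (mxvec rhon); rewrite /= mxvecK; exact: rhonP.
have cf : {within [set w : 'rV[R]_(s * N) | densities (vec_mx w)],
    continuous reduced}.
  by apply: continuous_in_subspaceT => w /set_mem; exact: continuous_reduced.
have [w /set_mem Dw w_min] := compact_EVT_min ne compact_densities cf.
exists (state_of (vec_mx w)); split; first exact/admissibleP.
move=> v /admissibleP[Dv ->]; rewrite -[v.1.1]mxvecK.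
by apply: w_min; apply/mem_set; rewrite /= mxvecK.
Qed.

Lemma minimizer_unique u v :
  is_minimizer (objective d tau) (admissible d delta rhon) u ->
  is_minimizer (objective d tau) (admissible d delta rhon) v -> u = v.
Proof.
move=> [Au u_min] [Av v_min].
have [/admissibleP[_ uE] /admissibleP[_ vE]] := (Au, Av).
have [rhoE|rho_neq] := eqVneq u.1.1 v.1.1; first by rewrite uE vE rhoE.
have Am := admissible_midpoint Au Av.
have := objective_midpoint_lt Au Av rho_neq.
by rewrite ltNge lerD// ?u_min ?v_min.
Qed.
End ReducedProblem.

Theorem theorem3p1 (R : realType) (s N : nat) (d : pnp_data R s N)
    (tau delta : R) (rhon : 'M[R]_(s, N))
    (s_ge1 : (1 <= s)%N) (N_ge1 : (1 <= N)%N) (ltab : pa d < pb d)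
    (diffusion_gt0 : forall i x, pa d <= x <= pb d -> 0 < diffusion d i x)
    (eps_gt0 : forall x, pa d <= x <= pb d -> 0 < eps d x)
    (beta_a_gt0 : 0 < beta_a d) (beta_b_gt0 : 0 < beta_b d)
    (tau_gt0 : 0 < tau) (delta_gt0 : 0 < delta)
    (rhonP : forall i, density_set d delta (row i rhon)) :
  exists! u : unknowns, is_minimizer (objective d tau) (admissible d delta rhon) u.
Proof.
have [u u_min] : exists u, is_minimizer (objective d tau) (admissible d delta rhon) u.
  exact: exists_minimizer.
by exists u; split=> // v; exact: minimizer_unique.
Qed.
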